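(* Let $G$ be a finite simple chordal graph, let $K$ be a field and $S=K[x_v : v\in V(G)]$. Then $\operatorname{reg}(S/NI(G))=\tau(G)$.
   Context: For a finite simple graph $G$ and a vertex $v$, $N_G[v]=\{v\}\cup\{w : \{v,w\}\in E(G)\}$ is the closed neighborhood of $v$. The closed neighborhood ideal of $G$ is the squarefree monomial ideal $NI(G)=\big(\prod_{w\in N_G[v]} x_w : v\in V(G)\big)\subseteq S$. A vertex cover of $G$ is a set $C\subseteq V(G)$ meeting every edge; $\tau(G)$ (the vertex cover number) is the minimum size of a vertex cover. A graph is chordal if every cycle of length at least $4$ has a chord. $\operatorname{reg}$ denotes Castelnuovo–Mumford regularity. The field $K$ is assumed infinite. *)

(* Defs.v *)
From HB Require Import structures.
From mathcomp Require Import all_boot all_order all_algebra.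
Set Implicit Arguments. Unset Strict Implicit. Unset Printing Implicit Defensive.
Import Order.TTheory GRing.Theory Num.Theory.

(* A finite simple graph on the vertex type T is a symmetric irreflexive
   relation e : rel T (both properties are hypotheses of the theorem). *)

Section Graphs.
Variable T : finType.
Variable e : rel T.

Definition closed_nbhd (v : T) : {set T} := v |: [set w | e v w].

Definition vertex_cover (C : {set T}) : bool :=
  [forall x, forall y, e x y ==> (x \in C) || (y \in C)].

(* tau(G): minimum size of a vertex cover ([set: T] is always a cover) *)
Definition vertex_cover_number : nat :=
  #|[arg min_(C < [set: T] | vertex_cover C) #|C|]|.

Definition chordal : Prop :=
  forall s : seq T, uniq s -> 4 <= size s -> cycle e s ->
    exists x y, [/\ x \in s, y \in s, e x y, next s x != y & next s y != x].
End Graphs.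

(* Variables of S = K[x_v : v in T] are indexed by T; a monomial is an
   exponent vector a : {ffun T -> nat}.  A squarefree monomial ideal is
   given by a list of generators, each generator prod_{w in g} x_w being
   encoded by its support g : {set T}. *)

Section Betti.
Variable K : fieldType.
Variable T : finType.
Variable gens : seq {set T}.

Definition mon_in (b : {ffun T -> nat}) : bool :=
  has (fun g : {set T} => [forall w in g, 0 < b w]%N) gens.

Definition mdeg (a : {ffun T -> nat}) : nat := (\sum_(x : T) a x)%N.

Definition mdiv (a : {ffun T -> nat}) (F : {set T}) : {ffun T -> nat} :=
  [ffun x => (a x - (x \in F))%N].

(* Multidegree-a part of the Koszul complex K(x_T ; S/I):
   K_i = \bigoplus_{|F| = i} (S/I)(-F) e_F, whose degree-a component has
   the K-basis { e_F : |F| = i, x_F | x^a, x^{a-F} \notin I }. *)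
Definition kbasis (i : nat) (a : {ffun T -> nat}) : {set {set T}} :=
  [set F : {set T} | [&& #|F| == i, [forall x in F, 0 < a x]%N
                       & ~~ mon_in (mdiv a F)]].

(* sign of x_j in d(e_F) = sum_{j in F} (-1)^{#{k in F, k < j}} x_j e_{F\j},
   for the total order on T given by enum_rank *)
Definition ksign (F : {set T}) (j : T) : K :=
  (-1) ^+ #|[set k in F | enum_rank k < enum_rank j]|.

(* Matrix (row-vector convention) of the Koszul differential
   d_i : K_i -> K_{i-1} in multidegree a, indexed by all subsets of T
   (rows/columns outside the basis are zero). *)
Definition kdiff (i : nat) (a : {ffun T -> nat}) : 'M[K]_#|{: {set T}}| :=
  \matrix_(p < #|{: {set T}}|, q < #|{: {set T}}|)
    let F : {set T} := enum_val p in let G : {set T} := enum_val q in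
    if (F \in kbasis i a) && (G \in kbasis i.-1 a)
    then (\sum_(j in F | G == F :\ j) ksign F j)%R else 0%R.

(* multigraded Betti number beta_{i,a}(S/I) = dim_K Tor_i^S(S/I, K)_a
   = dim_K H_i(K(x_T; S/I))_a *)
Definition betti (i : nat) (a : {ffun T -> nat}) : nat :=
  (#|kbasis i a| - \rank (kdiff i a) - \rank (kdiff i.+1 a))%N.

(* reg(S/I) = max { j - i : beta_{i,j}(S/I) <> 0 },
   with beta_{i,j} = sum_{|a| = j} beta_{i,a}. *)
Definition is_regularity (r : int) : Prop :=
  (exists i a, betti i a != 0%N /\ (Posz (mdeg a) - Posz i)%R = r) /\
  (forall i a, betti i a != 0%N -> (Posz (mdeg a) - Posz i <= r)%R).
End Betti.

Definition NI_gens (T : finType) (e : rel T) : seq {set T} :=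
  [seq closed_nbhd e v | v <- enum T].

(* Main.v *)
(* The multidegree-[a] part of the Koszul complex of S/NI(G) has a cell for each
   set F such that x^(a-F) is not in NI(G).  If some exponent of [a] exceeds 1,
   these cells form a cone.  If [a] is squarefree with support Y, the cells are
   the F contained in Y whose union with the complement of Y dominates G.
   Let v be simplicial in G and x a neighbour of v.  The cells containing x
   dominate G iff they dominate G - v, as x already dominates everything v does;
   the cells avoiding x dominate G iff they dominate G - x, as whatever dominates
   v also dominates x.  The cells avoiding x form a subcomplex with the others as
   quotient.  Removing x from G lowers the vertex cover number by one, whereas
   removing v does not raise it: by induction there is no homology in degrees
   i < |Y| - tau(G).  For Y = V(G), the cells containing x form a cone over v, so
   the nonzero class of G - x survives, and it lies in degree |V(G)| - tau(G). *)

Require Import Defs.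
From mathcomp Require Import all_boot all_order all_algebra.
Set Implicit Arguments. Unset Strict Implicit. Unset Printing Implicit Defensive.
Import Order.TTheory GRing.Theory Num.Theory.

(** * Chains on a family of sets *)

Section Chains.
Variables (K : fieldType) (T : finType).
Implicit Types (f g : {set T} -> K) (P : pred {set T}) (F G : {set T}).
Local Open Scope ring_scope.

(** A function [f] stands for the chain sum of [f F] e_F. This is the coefficient of e_G in its
    Koszul differential, hence a sum over supersets of [G]. *)
Definition boundary f G : K :=
  \sum_(j | j \notin G) ksign K (j |: G) j * f (j |: G).

Definition boundary_in P f G : K := if P G then boundary f G else 0.

Definition chain P n f : Prop :=
  forall F, ~~ (P F && (#|F| == n)) -> f F = 0.

Definition exact_at P n : Prop :=
  forall f, chain P n f -> (forall G, P G -> boundary f G = 0) ->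
  exists2 g, chain P n.+1 g & forall G, P G -> boundary g G = f G.

(** Convex families span subquotients of the complex on all subsets; convexity makes the truncated
    differential [boundary_in] square to zero. *)
Definition convex P : Prop :=
  forall F G H, P F -> P H -> F \subset G -> G \subset H -> P G.

Lemma ksign_setU1 G j :
  ksign K (j |: G) j = (-1) ^+ #|[set k in G | (enum_rank k < enum_rank j)%N]|.
Proof.
rewrite /ksign; congr (_ ^+ #|pred_of_set _|); apply/setP => k; rewrite !inE.
by case: eqP => [->|//]; rewrite ltnn !andbF.
Qed.

Lemma ksign_setU1_lt G j k : k \notin G -> (enum_rank k < enum_rank j)%N ->
  ksign K (j |: (k |: G)) j = - ksign K (j |: G) j.
Proof.
move=> kG kj; rewrite !ksign_setU1 -[RHS]mulN1r -exprS; congr (_ ^+ _).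
rewrite (cardsD1 k) !inE eqxx kj /= add1n; congr _.+1; apply: eq_card => l.
by rewrite !inE; case: eqP => [->|//]; rewrite (negbTE kG).
Qed.

Lemma ksign_setU1_gt G j k : (enum_rank k < enum_rank j)%N ->
  ksign K (k |: (j |: G)) k = ksign K (k |: G) k.
Proof.
move=> kj; rewrite !ksign_setU1; congr (_ ^+ _); apply: eq_card => l.
rewrite !inE; case: eqP => [->|//].
by rewrite [(enum_rank j < _)%N]ltnNge (ltnW kj) !andbF.
Qed.

Lemma ksign_neq0 F j : ksign K F j != 0.
Proof. by rewrite signr_eq0. Qed.

Lemma boundary_boundary f G : boundary (boundary f) G = 0.
Proof.
pose t j k := ksign K (j |: G) j *
  (ksign K (k |: (j |: G)) k * f (k |: (j |: G))).
have -> : boundary (boundary f) G =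
  \sum_(j | j \notin G) \sum_(k | (k \notin G) && (k != j)) t j k.
  apply: eq_bigr => j jG; rewrite /boundary mulr_sumr; apply: eq_bigl => k.
  by rewrite in_setU1 negb_or andbC.
(* The terms for (j, k) and (k, j) have opposite signs; splitting by the order of j and k makes the
   two halves cancel. *)
pose L (j k : T) := (enum_rank k < enum_rank j)%N.
under eq_bigr => j _ do rewrite (bigID (L j)) /=.
rewrite big_split /=.
have -> : \sum_(j | j \notin G)
    \sum_(k | (k \notin G) && (k != j) && ~~ L j k) t j k =
  \sum_(j | j \notin G) \sum_(k | (k \notin G) && (k != j) && L j k) t k j.
  rewrite (exchange_big_dep (fun k => k \notin G)) /=; last first.
    by move=> j k _ /andP[/andP[]].
  apply: eq_bigr => k kG; apply: eq_bigl => j; rewrite kG /= eq_sym -!andbA.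
  case: (j \notin G) => //=; case: eqP => //= /eqP jk; rewrite /L -leqNgt.
  by rewrite leq_eqVlt (inj_eq val_inj) (inj_eq enum_rank_inj) (negbTE jk).
rewrite -big_split big1 //= => j jG; rewrite -big_split big1 //= => k.
move=> /andP[/andP[kG _] kj];
rewrite /t (ksign_setU1_lt kG kj) ksign_setU1_gt // [j |: (k |: G)]setUCA.
by rewrite !mulrA mulrN mulNr [_ * ksign _ (k |: G) k]mulrC addrN.
Qed.

Lemma boundaryB f g G :
  boundary (fun F => f F - g F) G = boundary f G - boundary g G.
Proof. by rewrite /boundary -sumrB; apply: eq_bigr => j _; rewrite mulrBr. Qed.

Lemma boundary_supp f G (j : T) : j \notin G ->
    (forall k, k \notin G -> k != j -> f (k |: G) = 0) ->
  boundary f G = ksign K (j |: G) j * f (j |: G).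
Proof.
move=> jG f0; rewrite /boundary (bigD1 j) //= big1 ?addr0 // => k /andP[kG kj].
by rewrite f0 ?mulr0.
Qed.

(** A term dropped because [j |: G] lies outside [P] was zero anyway: a cell [k |: (j |: G)] in [P]
    would, with [G], put [j |: G] in [P] by convexity. *)
Lemma boundary_boundary_in P n f G : convex P -> chain P n f -> P G ->
  boundary (boundary_in P f) G = 0.
Proof.
move=> cP cf PG; rewrite -(boundary_boundary f G); apply: eq_bigr => j jG.
rewrite /boundary_in; case: ifPn => // NP; congr (_ * _); symmetry.
apply: big1 => k kjG; rewrite cf ?mulr0 //; apply: contra NP => /andP[Pk _].
by apply: cP PG Pk _ _; rewrite subsetUr.
Qed.

Lemma chain_boundary_in P n f : chain P n.+1 f -> chain P n (boundary_in P f).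
Proof.
move=> cf F; rewrite /boundary_in; case: (P F) => //= nF.
rewrite /boundary big1 // => j jF; rewrite cf ?mulr0 // cardsU1 jF.
by rewrite add1n eqSS (negbTE nF) andbF.
Qed.

Lemma chainB P n f g : chain P n f -> chain P n g ->
  chain P n (fun F => f F - g F).
Proof. by move=> cf cg F nF; rewrite cf // cg // subrr. Qed.

Lemma eq_exact_at P P' n : P =1 P' -> exact_at P n -> exact_at P' n.
Proof.
move=> PP ex f cf f0; have [|G PG|g cg gf] := ex f.
- by move=> F; rewrite PP; apply: cf.
- by rewrite f0 -?PP.
- exists g => [F|G]; first by rewrite -PP; apply: cg.
  by rewrite -PP; apply: gf.
Qed.

Lemma exact_at_empty P n : (forall F, P F -> #|F| != n) -> exact_at P n.
Proof.
move=> P0 f cf f0; exists (fun=> 0) => // G PG.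
rewrite cf ?(negbTE (P0 _ PG)) ?andbF // /boundary big1 // => j _.
by rewrite mulr0.
Qed.

(* A coordinate [x] on which [P] does not depend yields the contracting
   homotopy [F |-> x |: F]. *)
Lemma exact_at_cone P (x : T) n : convex P ->
  (forall F, P (x |: F) = P (F :\ x)) -> exact_at P n.
Proof.
move=> cP Px f cf f0.
have PU F : P (x |: F) = P F.
  have [xF|xF] := boolP (x \in F); last first.
    rewrite Px; congr P; apply/setP=> y; rewrite !inE.
    by case: eqP => // ->; rewrite (negbTE xF).
  by congr P; apply/setP=> y; rewrite !inE; case: eqP => // ->.
have PD F : P (F :\ x) = P F by rewrite -Px PU.
pose h F := if x \in F then ksign K F x * f (F :\ x) else 0.
have ch : chain P n.+1 h.
  move=> F; rewrite /h; case: ifP => // xF; rewrite -PD (cardsD1 x) xF /=.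
  by rewrite add1n eqSS => /cf ->; rewrite mulr0.
exists h => // G PG.
(* Subtracting the boundary of [h] kills [f] on all sets avoiding [x]; in the boundary of [k] at
   [G :\ x] only the term of [k G] then survives. *)
pose k F := f F - boundary_in P h F.
have ck : chain P n k by apply: chainB => //; apply: chain_boundary_in.
have k0 F : x \notin F -> k F = 0.
  move=> xF; have [PF|PF] := boolP (P F); last by rewrite ck ?(negbTE PF).
  rewrite /k /boundary_in PF (boundary_supp xF) => [|j jF jx]; last first.
    by rewrite /h !inE eq_sym (negbTE jx) (negbTE xF).
  rewrite /h setU11 setU1K // mulrA ksign_setU1 -expr2 sqrr_sign mul1r.
  by rewrite subrr.
have kG : k G = 0.
  have [xG|/k0//] := boolP (x \in G).
  have xGx : x \notin G :\ x by rewrite !inE eqxx.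
  have : boundary k (G :\ x) = 0.
    rewrite boundaryB f0 ?PD // (boundary_boundary_in _ ch) ?subrr // ?PD //.
  rewrite (boundary_supp xGx) => [|j jG jx]; last first.
    by rewrite k0 // !inE eqxx eq_sym (negbTE jx).
  rewrite setD1K // => /eqP.
  by rewrite mulf_eq0 (negbTE (ksign_neq0 _ _)) => /eqP.
by move: kG; rewrite /k /boundary_in PG => /eqP; rewrite subr_eq0 => /eqP.
Qed.

(** * The subcomplex of cells avoiding [x] and its quotient, spanned by the cells containing [x] *)

Section Split.
Variables (P : pred {set T}) (x : T) (n : nat).
Hypothesis cP : convex P.
Let Pin F := P F && (x \in F).
Let Pout F := P F && (x \notin F).

Lemma boundary_in_part f G : x \in G ->
  boundary (fun F => if x \in F then f F else 0) G = boundary f G.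
Proof. by move=> xG; apply: eq_bigr => j _; rewrite !inE xG orbT. Qed.

(** Exactness of the quotient yields a [g] whose boundary, once subtracted, pushes [f] into the
    subcomplex of sets avoiding [x]. *)
Lemma exact_at_reduce m f : exact_at Pin m -> chain P m f ->
    (forall G, Pin G -> boundary f G = 0) ->
  exists2 g, chain P m.+1 g & forall F, x \in F -> f F = boundary_in P g F.
Proof.
move=> exI cf f0.
have [F|G PG|g cg gf] := exI (fun F => if x \in F then f F else 0).
- rewrite negb_and /Pin; case: ifP => // xF; rewrite andbT -negb_and.
  by move/cf.
- by rewrite boundary_in_part ?f0 //; case/andP: PG.
exists g => [F nF|F xF].
  by rewrite cg //; apply: contra nF => /andP[/andP[-> _]].
rewrite /boundary_in; case: ifPn => PF; first by rewrite gf /Pin ?PF xF.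
by rewrite cf // (negbTE PF).
Qed.

Lemma exact_at_split : exact_at Pin n -> exact_at Pout n -> exact_at P n.
Proof.
move=> exI exO f cf f0.
have [G /andP[]|g cg gf] := exact_at_reduce exI cf; first by move=> /f0.
pose k F := f F - boundary_in P g F.
have ck : chain P n k by apply: chainB => //; apply: chain_boundary_in.
have k0 G : P G -> boundary k G = 0.
  by move=> PG; rewrite boundaryB f0 // (boundary_boundary_in cP cg) // subrr.
have [F|G /andP[/k0]//|h ch hk] := exO k.
  rewrite /Pout; have [xF _|xF] := boolP (x \in F).
    by rewrite /k gf // subrr.
  by rewrite andbT; apply: ck.
exists (fun F => g F + h F) => [F nF|G PG].
  by rewrite cg // ch ?addr0 // /Pout; apply: contra nF => /andP[/andP[-> _]].
have -> : boundary (fun F => g F + h F) G = boundary g G + boundary h G.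
  by rewrite /boundary -big_split; apply: eq_bigr => j _; rewrite mulrDr.
have [xG|xG] := boolP (x \in G); last first.
  by rewrite hk /Pout ?PG // /k /boundary_in PG addrC subrK.
rewrite gf // /boundary_in PG /boundary [X in _ + X]big1 ?addr0 // => j _.
by rewrite ch ?mulr0 // /Pout !inE xG orbT andbF.
Qed.

(** A piece of the long exact sequence: [f] bounds some [g] in [P]. As [f] vanishes on sets
    containing [x], the part of [g] there is a cycle of the quotient, so a boundary corrects [g] to
    avoid [x]. *)
Lemma exact_at_out : exact_at Pin n.+1 -> exact_at P n -> exact_at Pout n.
Proof.
move=> exI exP f cf f0.
have [F|G PG|g cg gf] := exP f.
- by move=> nF; apply: cf; rewrite /Pout andbAC; apply: contra nF => /andP[].
- have [xG|xG] := boolP (x \in G); last by rewrite f0 // /Pout PG.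
  apply: big1 => j _; rewrite cf ?mulr0 // /Pout !inE xG orbT andbF //.
have [G /andP[PG xG]|h ch hg] := exact_at_reduce exI cg.
  by rewrite gf // cf // /Pout xG andbF.
exists (fun F => g F - boundary_in P h F) => [F|G /andP[PG xG]].
  rewrite /Pout; have [xF _|xF] := boolP (x \in F).
    by rewrite hg // subrr.
  rewrite andbT => nF; rewrite cg //.
  by rewrite (chain_boundary_in ch) ?subrr.
by rewrite boundaryB (boundary_boundary_in cP ch) // subr0 gf.
Qed.
End Split.
End Chains.

(** * Betti numbers and exactness *)

Section BettiExact.
Variables (K : fieldType) (T : finType) (gens : seq {set T}).
Variable (a : {ffun T -> nat}).
Implicit Types (f g : {set T} -> K) (F G : {set T}).
Local Open Scope ring_scope.

Definition koszul_cell F : bool :=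
  [forall x in F, 0 < a x]%N && ~~ mon_in gens (mdiv a F).

Lemma in_kbasis i F :
  (F \in kbasis gens i a) = koszul_cell F && (#|F| == i).
Proof. by rewrite inE andbC. Qed.

(** Growing [F] lowers the exponents of x^(a-F), so lying outside the ideal passes to supersets,
    while the support condition passes to subsets. *)
Lemma convex_koszul_cell : convex koszul_cell.
Proof.
move=> F G H /andP[_ nF] /andP[/forall_inP aH _] FG GH; apply/andP; split.
  by apply/forall_inP => x /(subsetP GH); apply: aH.
apply: contra nF => /hasP[g gg /forall_inP gG]; apply/hasP; exists g => //.
apply/forall_inP => w /gG; rewrite !ffunE => /leq_trans; apply.
by apply: leq_sub2l; case: (boolP (w \in F)) => // /(subsetP FG) ->.
Qed.

Definition chain_row f : 'rV[K]_#|{: {set T}}| := \row_q f (enum_val q).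

Lemma chain_row_inj f g : chain_row f = chain_row g -> f =1 g.
Proof.
by move/rowP => fg F; have := fg (enum_rank F); rewrite !mxE enum_rankK.
Qed.

Lemma chain_rowK (u : 'rV[K]_#|{: {set T}}|) :
  chain_row (fun F => u 0 (enum_rank F)) = u.
Proof. by apply/rowP => q; rewrite mxE enum_valK. Qed.

Lemma boundaryE f G : boundary f G =
  \sum_F f F * \sum_(j in F | G == F :\ j) ksign K F j.
Proof.
under [RHS]eq_bigr => F _ do rewrite mulr_sumr.
rewrite (exchange_big_dep (fun j => j \notin G)) /=; last first.
  by move=> F j _ /andP[_ /eqP->]; rewrite !inE eqxx.
apply: eq_bigr => j jG.
rewrite (big_pred1 (j |: G)) => [|F /=]; first exact: mulrC.
apply/andP/eqP => [[jF /eqP->]|->]; first by rewrite setD1K.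
by rewrite setU11 setU1K.
Qed.

(** Off degree [i.-1] both sides vanish. For [i = 0], where [i.-1] is again 0, the only candidate
    entry is at the empty set and is an empty sum. *)
Lemma chain_row_kdiff i f :
  chain koszul_cell i f ->
  chain_row f *m kdiff K gens i a = chain_row (boundary_in koszul_cell f).
Proof.
move=> cf; apply/rowP => q; rewrite !mxE; set G := enum_val q.
transitivity (if G \in kbasis gens i.-1 a then boundary f G else 0).
  rewrite boundaryE (reindex (fun p : 'I_#|{: {set T}}| => enum_val p)) /=;
    last first.
    by exists enum_rank => ? _; rewrite ?enum_rankK ?enum_valK.
  case: ifPn => Gb; last first.
    by rewrite big1 // => p _; rewrite !mxE /= -/G (negbTE Gb) andbF mulr0.
  apply: eq_bigr => p _; rewrite !mxE /= -/G Gb andbT.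
  by case: ifPn => //; rewrite in_kbasis => /cf ->; rewrite !mul0r.
rewrite in_kbasis /boundary_in; case: (koszul_cell G) => //=.
case: ifPn => // nG; symmetry; apply: big1 => j jG; rewrite cf ?mulr0 //.
rewrite cardsU1 jG add1n; apply: contra nG => /andP[_ /eqP<-] //.
Qed.

Let cell_mx i : 'M[K]_(#|kbasis gens i a|, #|{: {set T}}|) :=
  rowsub (fun p => enum_rank (enum_val p)) 1%:M.

Lemma cell_mx_rank i : \rank (cell_mx i) = #|kbasis gens i a|.
Proof.
apply/eqP; apply/row_freeP; exists (cell_mx i)^T; apply/matrixP => p q.
rewrite mul_rowsub_mx mul1mx !mxE (inj_eq enum_rank_inj) (inj_eq enum_val_inj).
by rewrite eq_sym.
Qed.

Lemma delta_sub_cell_mx i F : F \in kbasis gens i a ->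
  (delta_mx (0 : 'I_1) (enum_rank F) <= cell_mx i)%MS.
Proof.
move=> Fi.
have -> : delta_mx 0 (enum_rank F) = row (enum_rank_in Fi F) (cell_mx i).
  by rewrite row_rowsub row1 enum_rankK_in.
exact: row_sub.
Qed.

Lemma chain_row_sub i f :
  (chain_row f <= cell_mx i)%MS <-> chain koszul_cell i f.
Proof.
split => [/submxP[w] /rowP wE F nF|cf].
  have := wE (enum_rank F); rewrite !mxE enum_rankK => ->; apply: big1 => p _.
  rewrite !mxE (inj_eq enum_rank_inj); case: eqP => [pF|]; last by rewrite mulr0.
  by move: (enum_valP p); rewrite in_kbasis pF (negbTE nF).
rewrite [chain_row f]row_sum_delta summx_sub // => q _; rewrite mxE.
have [/cf->|] := boolP (~~ (koszul_cell (enum_val q) && (#|enum_val q| == i))).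
  by rewrite scale0r sub0mx.
rewrite negbK -in_kbasis => /delta_sub_cell_mx; rewrite enum_valK.
exact: scalemx_sub.
Qed.

Lemma kdiff_restrict i g : chain_row g *m kdiff K gens i a =
  chain_row (fun F => if F \in kbasis gens i a then g F else 0)
    *m kdiff K gens i a.
Proof.
apply/rowP => q; rewrite !mxE; apply: eq_bigr => p _; rewrite !mxE /=.
by case: (_ \in kbasis gens i a); rewrite //= !mulr0.
Qed.

Lemma chain_restrict i g : chain koszul_cell i
  (fun F => if F \in kbasis gens i a then g F else 0).
Proof. by move=> F; rewrite in_kbasis => /negbTE ->. Qed.

Lemma rank_kdiff i :
  \rank (cell_mx i *m kdiff K gens i a) =
  \rank (kdiff K gens i a).
Proof.
apply/eqP; rewrite eqn_leq mxrankM_maxr mxrankS //; apply/row_subP => q.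
rewrite rowE -[delta_mx _ _]chain_rowK kdiff_restrict.
by apply/submxMr/chain_row_sub/chain_restrict.
Qed.

(** The matrix [kdiff] is indexed by all subsets, so its kernel also contains every row supported
    outside the basis; the intersection discards these. *)
Let cycles i := (cell_mx i :&: kermx (kdiff K gens i a))%MS.

Lemma cyclesP i f : (chain_row f <= cycles i)%MS <->
  chain koszul_cell i f /\ forall G, koszul_cell G -> boundary f G = 0.
Proof.
rewrite sub_capmx; split=> [/andP[/chain_row_sub cf]|[cf f0]].
  move/sub_kermxP; rewrite chain_row_kdiff // => f0; split=> // G PG.
  have := @chain_row_inj (boundary_in koszul_cell f) (fun=> 0) _ G.
  by rewrite /boundary_in PG; apply; rewrite f0; apply/rowP => q; rewrite !mxE.
apply/andP; split; first exact/chain_row_sub.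
apply/sub_kermxP; rewrite chain_row_kdiff //; apply/rowP => q; rewrite !mxE.
by rewrite /boundary_in; case: ifP => // /f0.
Qed.

Lemma boundaries_sub_cycles i : (kdiff K gens i.+1 a <= cycles i)%MS.
Proof.
apply/row_subP => q; rewrite rowE -[delta_mx _ _]chain_rowK kdiff_restrict.
set f := fun F => _; have cf : chain koszul_cell i.+1 f := @chain_restrict _ _.
rewrite chain_row_kdiff //; apply/cyclesP; split.
  exact: chain_boundary_in.
by move=> G; apply: (boundary_boundary_in convex_koszul_cell cf).
Qed.

Lemma betti_eq0 i : betti K gens i a = 0%N <-> exact_at K koszul_cell i.
Proof.
(* Rank-nullity on the space of chains. Boundaries being cycles, the truncated difference is zero
   exactly when the two spaces agree. *)
have -> : betti K gens i a = (\rank (cycles i) - \rank (kdiff K gens i.+1 a))%N.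
  rewrite /betti -(cell_mx_rank i) -rank_kdiff.
  by rewrite -(mxrank_mul_ker (cell_mx i) (kdiff K gens i a)) addKn.
have [rle rif] := mxrank_leqif_sup (boundaries_sub_cycles i).
split=> [/eqP|ex].
  rewrite subn_eq0 => rge f cf f0.
  have cyc : (cycles i <= kdiff K gens i.+1 a)%MS by rewrite -rif eqn_leq rle.
  have /submxP[w] := submx_trans ((cyclesP i f).2 (conj cf f0)) cyc.
  rewrite -(chain_rowK w) kdiff_restrict.
  set g := fun F => _; have cg : chain koszul_cell i.+1 g := @chain_restrict _ _.
  rewrite chain_row_kdiff // => /chain_row_inj fE; exists g => // G PG.
  by rewrite fE /boundary_in PG.
apply/eqP; rewrite subn_eq0 mxrankS //; apply/row_subP => p.
rewrite -[row p _]chain_rowK; set f := fun F => _.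
have /cyclesP[cf f0] : (chain_row f <= cycles i)%MS.
  by rewrite chain_rowK row_sub.
have [g cg gf] := ex f cf f0.
have -> : chain_row f = chain_row (boundary_in koszul_cell g).
  apply/rowP => q; rewrite !mxE /boundary_in -/(f (enum_val q)).
  by case: ifPn => [/gf //|nP]; rewrite cf ?(negbTE nP).
by rewrite -(chain_row_kdiff cg) submxMl.
Qed.
End BettiExact.

(** * Dominating sets and simplicial vertices *)

Section Domination.
Variables (T : finType) (e : rel T).
Hypotheses (e_sym : symmetric e) (e_irr : irreflexive e).
Implicit Types (V X Y R A C F : {set T}).

(** Domination in the subgraph induced on [V]: elements of [A] outside [V] do not help. *)
Definition dominates V A : bool :=
  [forall u in V, exists w in V, (w \in A) && (w \in closed_nbhd e u)].

Definition simplicial V v : Prop :=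
  v \in V /\ {in V &, forall x y, e v x -> e v y -> x != y -> e x y}.

Definition covers V C : Prop :=
  {in V &, forall x y, e x y -> (x \in C) || (y \in C)}.

Lemma dominatesP V A : reflect
  (forall u, u \in V -> exists w, [/\ w \in V, w \in A & (w == u) || e u w])
  (dominates V A).
Proof.
apply: (iffP forall_inP) => dVA u /dVA.
  by move=> /exists_inP[w wV]; rewrite !inE => /andP[wA uw]; exists w.
by case=> w [wV wA uw]; apply/exists_inP; exists w => //; rewrite !inE wA.
Qed.

Lemma dominatesS V A A' :
  {in V, {subset A <= A'}} -> dominates V A -> dominates V A'.
Proof.
move=> AA' /dominatesP dVA; apply/dominatesP => u /dVA[w [wV wA uw]].
by exists w; split=> //; apply: AA'.
Qed.

Lemma eq_dominates V A A' : {in V, A =i A'} -> dominates V A = dominates V A'.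
Proof.
move=> AA'; apply/idP/idP; apply: dominatesS => w wV; first by rewrite AA'.
by rewrite AA'.
Qed.

Lemma dominates_isolated V A v : v \in V -> {in V, forall x, ~~ e v x} ->
  dominates V A = (v \in A) && dominates (V :\ v) A.
Proof.
move=> vV v0; apply/dominatesP/andP => [dVA|[vA /dominatesP dVA] u uV].
  split.
    have [w [wV wA /orP[/eqP<-//|vw]]] := dVA v vV.
    by rewrite (negbTE (v0 w wV)) in vw.
  apply/dominatesP => u /setD1P[uv uV]; have [w [wV wA uw]] := dVA u uV.
  exists w; split=> //; rewrite !inE wV andbT; apply: contraTneq uw => ->.
  by rewrite eq_sym (negbTE uv) e_sym (negbTE (v0 u uV)).
have [->|uv] := eqVneq u v; first by exists v; rewrite eqxx.
have [|w [/setD1P[_ wV] wA uw]] := dVA u; first by rewrite !inE uv.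
by exists w.
Qed.

(** By simpliciality [x] dominates all that [v] dominates, so it replaces [v] as a dominator; it
    also dominates [v] itself. *)
Lemma dominates_present V A v x : simplicial V v -> x \in V -> e v x ->
  x \in A -> dominates V A = dominates (V :\ v) A.
Proof.
move=> [vV sv] xV vx xA.
have xv : x != v by apply: contraTneq vx => ->; rewrite e_irr.
apply/dominatesP/dominatesP => [dVA u /setD1P[uv uV]|dVA u uV].
  have [w [wV wA uw]] := dVA u uV.
  have [wv|wv] := eqVneq w v; last by exists w; rewrite !inE wv.
  move: uw; rewrite wv eq_sym (negbTE uv) /= => uv'.
  exists x; rewrite !inE xv; split=> //; case: eqVneq => //= xu.
  by apply: sv => //; rewrite 1?eq_sym // e_sym.
have [->|uv] := eqVneq u v; first by exists x; rewrite vx orbT.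
have [|w [/setD1P[_ wV] wA uw]] := dVA u; first by rewrite !inE uv.
by exists w.
Qed.

(** No dominator is [x], so deleting [x] only drops the demand to dominate it, and whatever
    dominates [v] meets that demand. *)
Lemma dominates_absent V A v x : simplicial V v -> x \in V -> e v x ->
  x \notin A -> dominates V A = dominates (V :\ x) A.
Proof.
move=> [vV sv] xV vx xA.
have xv : x != v by apply: contraTneq vx => ->; rewrite e_irr.
apply/dominatesP/dominatesP => [dVA u /setD1P[ux uV]|dVA u uV].
  have [w [wV wA uw]] := dVA u uV; exists w; split=> //.
  by rewrite !inE wV andbT; apply: contraNneq xA => <-.
have [->|ux] := eqVneq u x; last first.
  have [|w [/setD1P[_ wV] wA uw]] := dVA u; first by rewrite !inE ux.
  by exists w.
have [|w [/setD1P[wx wV] wA vw]] := dVA v; first by rewrite !inE eq_sym xv.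
exists w; split=> //; rewrite (negbTE wx) /=.
case/orP: vw => [/eqP->|vw]; first by rewrite e_sym.
by apply: sv => //; rewrite eq_sym.
Qed.

Lemma covers_remove V C v x : simplicial V v -> x \in V -> e v x ->
  covers V C -> exists2 C', covers (V :\ x) C' & #|C'| < #|C|.
Proof.
move=> [vV sv] xV vx cC; have [xC|xC] := boolP (x \in C).
  exists (C :\ x); last by rewrite [X in _ < X](cardsD1 x) xC.
  move=> y z /setD1P[yx yV] /setD1P[zx zV] yz.
  by rewrite !inE yx zx; apply: cC.
have vC : v \in C by have := cC v x vV xV vx; rewrite (negbTE xC) orbF.
have NC y : y \in V -> y != x -> e v y -> y \in C.
  move=> yV yx vy; have := cC x y xV yV.
  by rewrite (negbTE xC) /=; apply; apply: sv; rewrite // eq_sym.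
exists (C :\ v); last by rewrite [X in _ < X](cardsD1 v) vC.
move=> y z /setD1P[yx yV] /setD1P[zx zV] yz; rewrite !inE.
have [yv|yv] := eqVneq y v.
  have zv : z != v by apply: contraTneq yz => ->; rewrite yv e_irr.
  by rewrite zv (NC z) // -yv.
have [zv|zv] := eqVneq z v; last exact: cC.
by rewrite NC // -zv e_sym.
Qed.

Lemma coversS V V' C : V' \subset V -> covers V C -> covers V' C.
Proof. by move=> /subsetP sV cC x y /sV xV /sV yV; apply: cC. Qed.

(* [X] is the set of vertices forced into [F], and [R] a set of vertices that
   dominate whether or not they lie in [F]: they are the vertices outside the
   multidegree under consideration. *)
Definition dom_family V X Y R : pred {set T} :=
  [pred F : {set T} | [&& X \subset F, F \subset Y & dominates V (F :|: R)]].

Lemma convex_dom_family V X Y R : convex (dom_family V X Y R).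
Proof.
move=> F G H /and3P[XF _ dF] /and3P[_ HY _] FG GH.
apply/and3P; split; [exact: subset_trans FG|exact: subset_trans HY|].
by apply: dominatesS dF => w _; apply/subsetP/setSU.
Qed.

(** Such a [y] is the apex of a cone, as [exact_at_cone] requires. *)
Lemma dom_family_free V X Y R y F : y \in Y -> y \notin X -> y \notin V ->
  dom_family V X Y R (y |: F) = dom_family V X Y R (F :\ y).
Proof.
move=> yY yX yV; rewrite /dom_family /= subsetD1 yX andbT subUset sub1set yY /=.
have -> : (X \subset y |: F) = (X \subset F).
  apply/subsetP/subsetP => XF w wX; have := XF w wX; rewrite !inE.
    by case: eqP wX => // ->; rewrite (negbTE yX).
  by move=> ->; rewrite orbT.
have -> : (F :\ y \subset Y) = (F \subset Y).
  by rewrite subDset (setUidPr _) ?sub1set.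
by do 2!congr andb; apply: eq_dominates => w wV; rewrite !inE;
  case: eqVneq => // wy; rewrite -wy wV in yV.
Qed.

Lemma dom_family_isolated_present V X Y R v :
  v \in V -> {in V, forall x, ~~ e v x} -> v \in R ->
  dom_family V X Y R =1 dom_family (V :\ v) X Y R.
Proof.
move=> vV v0 vR F.
by rewrite /dom_family /= (dominates_isolated _ vV v0) inE vR orbT.
Qed.

(** Only [v] can dominate [v], so it becomes a forced vertex. *)
Lemma dom_family_isolated V X Y R v :
  v \in V -> {in V, forall x, ~~ e v x} -> v \notin R ->
  dom_family V X Y R =1 dom_family (V :\ v) (v |: X) Y R.
Proof.
move=> vV v0 vR F.
rewrite /dom_family /= (dominates_isolated _ vV v0) inE (negbTE vR).
by rewrite orbF subUset sub1set; case: (v \in F); rewrite ?andbF //=.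
Qed.

Lemma dom_family_present V X Y R v x : simplicial V v -> x \in V -> e v x ->
  x \in X :|: R -> dom_family V X Y R =1 dom_family (V :\ v) X Y R.
Proof.
move=> sv xV vx xXR F; rewrite /dom_family /=.
case: (boolP (X \subset F)) => //= /subsetP XF.
rewrite (dominates_present sv xV vx) //.
by case/setUP: xXR => [/XF xF|xR]; rewrite inE ?xF ?xR ?orbT.
Qed.

Lemma dom_family_in V X Y R x F :
  dom_family V X Y R F && (x \in F) = dom_family V (x |: X) Y R F.
Proof.
rewrite /dom_family /= subUset sub1set.
by case: (x \in F); rewrite ?andbT ?andbF.
Qed.

Lemma dom_family_out V X Y R v x : simplicial V v -> x \in V -> e v x ->
  x \notin R -> forall F,
  dom_family V X Y R F && (x \notin F) = dom_family (V :\ x) X (Y :\ x) R F.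
Proof.
move=> sv xV vx xR F; rewrite /dom_family /= subsetD1.
case: (boolP (x \in F)) => xF; rewrite ?andbF //= !andbT.
by rewrite (dominates_absent sv xV vx) // inE negb_or xF.
Qed.

(** * Vanishing and nonvanishing of homology by deletion of vertices *)

Variable K : fieldType.
Hypothesis ex_simplicial : forall V, V != set0 -> exists v, simplicial V v.

Lemma dom_family_exact V X Y R C i : V \subset Y :|: R -> covers V C ->
  #|C| + i < #|Y| -> exact_at K (dom_family V X Y R) i.
Proof.
have [n] := ubnP #|V|; elim: n => // n IH in V X Y R C i * => Vn VYR cC Ci.
have IHD v X' : v \in V -> exact_at K (dom_family (V :\ v) X' Y R) i.
  move=> vV; apply: (IH _ _ _ _ C) => //.
  - by move: Vn; rewrite (cardsD1 v) vV.
  - by apply: subset_trans VYR; rewrite subD1set.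
  - by apply: coversS cC; rewrite subD1set.
(* With nothing left to dominate, either [Y] is the only possible cell, and too large for degree
   [i], or a vertex of [Y] outside [X] is a cone apex. *)
have [V0|V0] := eqVneq V set0.
  have [YX|/subsetPn[y yY yX]] := boolP (Y \subset X).
    apply: exact_at_empty => F /and3P[XF FY _].
    have -> : F = Y by apply/eqP; rewrite eqEsubset FY (subset_trans YX).
    by rewrite neq_ltn (leq_ltn_trans (leq_addl _ _) Ci) orbT.
  apply: (exact_at_cone (x := y)); first exact: convex_dom_family.
  by move=> F; apply: dom_family_free; rewrite // V0 inE.
have [v sv] := ex_simplicial V0; have vV := sv.1.
have [/existsP[x /andP[xV vx]]|] := boolP [exists x, (x \in V) && e v x].
  have pres X' : x \in X' :|: R -> exact_at K (dom_family V X' Y R) i.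
    move=> xX'; apply: eq_exact_at (IHD v X' vV) => F.
    by rewrite (dom_family_present _ sv xV vx).
  have [|] := boolP (x \in X :|: R); first exact: pres.
  rewrite inE negb_or => /andP[xX xR].
  have xY : x \in Y by have := subsetP VYR x xV; rewrite inE (negbTE xR) orbF.
  (* For the cells avoiding [x], [Y] loses one vertex and the cover at least one, so the inequality
     persists. *)
  apply: (exact_at_split (x := x)); first exact: convex_dom_family.
    apply: (eq_exact_at (P := dom_family V (x |: X) Y R)).
      by move=> F; rewrite dom_family_in.
    by apply: pres; rewrite !inE eqxx.
  apply: (eq_exact_at (P := dom_family (V :\ x) X (Y :\ x) R)).
    by move=> F; rewrite (dom_family_out _ _ sv xV vx).
  have [C' cC' C'C] := covers_remove sv xV vx cC.
  apply: (IH _ _ _ _ C') => //; first by move: Vn; rewrite (cardsD1 x) xV.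
    apply/subsetP => y /setD1P[yx /(subsetP VYR)]; rewrite !inE yx //.
  move: Ci; rewrite (cardsD1 x Y) xY add1n ltnS; apply: leq_trans.
  by rewrite -addSn leq_add2r.
rewrite negb_exists => /forallP v0.
have {}v0 : {in V, forall x, ~~ e v x} by move=> x xV; have := v0 x; rewrite xV.
have [vR|vR] := boolP (v \in R).
  apply: eq_exact_at (IHD v X vV) => F.
  by rewrite (dom_family_isolated_present _ _ vV v0).
apply: eq_exact_at (IHD v (v |: X) vV) => F.
by rewrite (dom_family_isolated _ _ vV v0).
Qed.

(** The cover [C] grows by [x] at each split while [m] stays fixed. It is not claimed to be minimum:
    comparison with the vanishing bound will show that. *)
Lemma dom_family_not_exact V X : [disjoint V & X] ->
  exists C m, [/\ C \subset V, covers V C, m + #|C| = #|X :|: V| &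
    ~ exact_at K (dom_family V X (X :|: V) set0) m].
Proof.
have [n] := ubnP #|V|; elim: n => // n IH in V X * => Vn VX.
have [V0|V0] := eqVneq V set0.
  (* The only cell is [X]; its indicator is a cycle, and there is no larger cell to bound it. *)
  exists set0, #|X|; rewrite V0 cards0 addn0 setU0; split=> //.
    by move=> x y; rewrite inE.
  have famX F : dom_family set0 X X set0 F = (F == X).
    rewrite eqEsubset andbC /dom_family /=; congr (_ && _); rewrite -[RHS]andbT.
    by congr (_ && _); apply/forall_inP => u; rewrite inE.
  have PX j : j \notin X -> (j |: X == X) = false.
    by move=> jX; apply/eqP => jX'; rewrite -jX' setU11 in jX.
  move=> /(_ (fun F => (F == X)%:R)%R)[F|G|g cg gf].
  - by rewrite famX; case: eqP => // ->; rewrite eqxx.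
  - rewrite famX => /eqP->; apply: big1 => j jX.
    by rewrite PX // mulr0.
  - have := gf X; rewrite famX eqxx => /(_ isT) /esym /eqP.
    rewrite /boundary big1 ?oner_eq0 // => j jX.
    by rewrite cg ?mulr0 // famX PX.
have [v sv] := ex_simplicial V0; have vV := sv.1.
have disjX w : w \in V -> w \notin X by move=> wV; rewrite (disjointFr VX).
have VnD w : w \in V -> #|V :\ w| < n.
  by move=> wV; move: Vn; rewrite (cardsD1 w) wV.
have [/existsP[x /andP[xV vx]]|] := boolP [exists x, (x \in V) && e v x].
  have xv : x != v by apply: contraTneq vx => ->; rewrite e_irr.
  have Yx : (X :|: V) :\ x = X :|: (V :\ x).
    apply/setP => w; rewrite !inE; case: eqVneq => //= ->.
    by rewrite orbF (negbTE (disjX x xV)).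
  have [||C [m [CV cC mC nex]]] := IH (V :\ x) X; first exact: VnD.
    by apply: disjointWl VX; rewrite subD1set.
  have xC : x \notin C.
    by apply/negP => /(subsetP CV); rewrite !inE eqxx.
  exists (x |: C), m; split.
  - by rewrite subUset sub1set xV (subset_trans CV) // subD1set.
  - move=> y z yV zV yz; rewrite !inE; case: eqVneq => //= yx.
    by case: eqVneq => [_|zx]; rewrite ?orbT //= cC // !inE ?yx ?zx.
  - by rewrite cardsU1 xC addnCA mC -Yx [RHS](cardsD1 x) !inE xV orbT.
  (* Exactness would descend to the cells avoiding [x], since those containing [x] are exact in
     every degree: once [v] leaves [V], it is a free apex. *)
  move=> ex; apply: nex; rewrite -Yx.
  apply: eq_exact_at (exact_at_out (x := x) (@convex_dom_family _ _ _ _) _ ex).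
    by move=> F; rewrite (dom_family_out _ _ sv xV vx) // inE.
  apply: (eq_exact_at (P := dom_family (V :\ v) (x |: X) (X :|: V) set0)).
    move=> F; rewrite dom_family_in (dom_family_present _ sv xV vx) //.
    by rewrite !inE eqxx.
  apply: (exact_at_cone (x := v)); first exact: convex_dom_family.
  move=> F; apply: dom_family_free; rewrite !inE ?vV ?orbT ?eqxx //.
  by rewrite eq_sym (negbTE xv) disjX.
rewrite negb_exists => /forallP v0.
have {}v0 : {in V, forall x, ~~ e v x} by move=> x xV; have := v0 x; rewrite xV.
have YE : (v |: X) :|: (V :\ v) = X :|: V.
  by rewrite setUC setUA [_ :|: [set v]]setUC setD1K // setUC.
have [||C [m [CV cC mC nex]]] := IH (V :\ v) (v |: X); first exact: VnD.
  rewrite -setI_eq0; apply/eqP/setP => w; rewrite !inE.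
  by case: eqVneq => //= _; case: (boolP (w \in V)) => //= /disjX/negbTE.
exists C, m; rewrite -YE; split=> //.
- by apply: subset_trans CV _; rewrite subD1set.
- move=> y z yV zV yz.
  have yv : y != v by apply: contraTneq yz => ->; apply: v0.
  have zv : z != v by apply: contraTneq yz => ->; rewrite e_sym; apply: v0.
  by apply: cC; rewrite // !inE ?yv ?zv.
move=> ex; apply: nex; apply: eq_exact_at ex => F.
by rewrite (dom_family_isolated _ _ vV v0) // inE.
Qed.
End Domination.

(** * Simplicial vertices of chordal graphs *)

Section Dirac.
Variables (T : finType) (e : rel T).
Hypotheses (e_sym : symmetric e) (e_irr : irreflexive e).
Hypothesis e_chordal : chordal e.

Lemma next_last (x : T) (p : seq T) :
  uniq (x :: p) -> next (x :: p) (last x p) = x.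
Proof. by move=> up; rewrite next_nth mem_last index_last // nth_default. Qed.

Lemma next_infix (x b : T) (p q : seq T) :
  uniq (x :: p ++ b :: q) -> next (x :: p ++ b :: q) (last x p) = b.
Proof.
move=> us; have up : uniq (x :: p).
  by move: us; rewrite -cat_cons cat_uniq => /andP[].
rewrite next_nth -(cat_cons x p) mem_cat mem_last index_cat mem_last.
by rewrite index_last //= nth_cat ltnn subnn.
Qed.

(** Close the path through [v]. If its ends were not adjacent, the cycle would have a chord; none
    ends at [v], so the chord shortens the path, and induction on its length applies. *)
Lemma bypass_adjacent v x r :
  path e x r -> uniq (x :: r) ->
  all (fun w => (w == last x r) || (w != v) && ~~ e v w) r ->
  e v x -> e v (last x r) -> last x r != x -> e x (last x r).
Proof.
have [n] := ubnP (size r); elim: n => // n IH in r * => rn.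
set y := last x r => pr ur ar vx vy yx; apply/negPn/negP => xy.
pose s := v :: x :: r.
have us : uniq s.
  rewrite [uniq s]/= -/(uniq (x :: r)) ur andbT inE negb_or.
  rewrite (contraTneq _ vx) /=; last by move=> <-; rewrite e_irr.
  apply/negP => /(allP ar); rewrite eqxx orbF => /eqP vy'.
  by rewrite -vy' e_irr in vy.
have s4 : 4 <= size s.
  rewrite /s; move: yx xy pr; rewrite /y; case: (r) => [|? []] //=.
    by rewrite eqxx.
  by move=> _ /negbTE->.
have cs : cycle e s by rewrite /s /= vx rcons_path pr -/y e_sym.
(* Here [a] precedes [b] on the cycle. If [a] is [v], then [b] is an end of the path, a cyclic
   neighbour of [v]; otherwise the path jumps from [a] to [b]. *)
have chord_r a b s1 s2 : s = s1 ++ b :: s2 -> a \in s1 -> e a b ->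
    next s a != b -> next s b != a -> False.
  case: s1 => // v' s1 [<-{v'} sE].
  have rE : x :: r = s1 ++ b :: s2 by [].
  rewrite inE; case: eqVneq => [-> _|av /= as1] ab nab nba.
    case: s1 rE {sE} => [|x' r1] rE.
      by case: rE => xb _; rewrite /s -xb /= eqxx eqxx in nab.
    case: rE => _ rE.
    have /(allP ar) : b \in r by rewrite rE mem_cat inE eqxx orbT.
    rewrite ab andbF orbF => /eqP bE; rewrite bE in nba.
    by rewrite (next_last us : next s y = v) eqxx in nba.
  case: s1 as1 rE {sE} => // x' r1 ar1 [xx' rE]; rewrite -{x'}xx' in ar1.
  case/splitPl: r1 / ar1 rE => p1 p2 lp1 rE.
  have p2N : p2 != [::].
    apply: contraNneq nab => p20; rewrite p20 cats0 in rE.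
    rewrite -lp1 /s rE; apply/eqP/(@next_infix v b (x :: p1) s2).
    by rewrite cat_cons -rE.
  have lr' : last x (p1 ++ b :: s2) = y by rewrite /y rE !last_cat /=.
  have sub : subseq (p1 ++ b :: s2) r.
    by rewrite rE -catA cat_subseq // suffix_subseq // suffix_suffix.
  apply: (negP xy); rewrite -lr'; apply: IH => //.
  - rewrite -ltnS; apply: leq_trans rn; rewrite ltnS rE !size_cat /= ltn_add2r.
    by rewrite -[X in X < _]addn0 ltn_add2l lt0n size_eq0.
  - move: pr; rewrite rE -catA !cat_path lp1 /= => /andP[-> /andP[_ /andP[_ ->]]].
    by rewrite ab.
  - by apply: subseq_uniq ur; rewrite /= eqxx.
  - by rewrite lr'; apply/allP => w /(mem_subseq sub) /(allP ar).
  - by rewrite lr'.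
  - by rewrite lr'.
have [a [b [ainS binS ab nab nba]]] := e_chordal us s4 cs.
have abN : a != b by apply: contraTneq ab => ->; rewrite e_irr.
have mem_split (z : T) t : z \in t -> exists t1 t2, t = t1 ++ z :: t2.
  by case/splitPr => t1 t2; exists t1, t2.
have [s1 [s2 sE]] := mem_split b s binS.
have : a \in s1 ++ b :: s2 by rewrite -sE.
rewrite mem_cat inE (negbTE abN) /= => /orP[as1|/mem_split[t1 [t2 tE]]].
  exact: chord_r sE as1 ab nab nba.
have {}sE : s = (s1 ++ b :: t1) ++ a :: t2 by rewrite sE tE -catA.
by apply: (chord_r b a _ _ sE); rewrite // 1?e_sym // mem_cat inE eqxx orbT.
Qed.

Lemma path_restrict_rel (Q : pred T) x p : Q x ->
  path [rel a b | [&& Q a, Q b & e a b]] x p -> path e x p && all Q (x :: p).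
Proof.
elim: p x => [|y p IH] x /= Qx; rewrite Qx //=.
by move=> /andP[/andP[Qy ->] /(IH y Qy)].
Qed.

(* The neighbours [S] of a component [H] of [V] minus the closed neighbourhood
   of [v] form a clique, because two of them are joined by a path through [H];
   so induction applies to [H :|: S], which misses [v]. *)
Lemma simplicial_nonadjacent (V : {set T}) v w :
  v \in V -> w \in V -> w != v -> ~~ e v w ->
  exists u, [/\ simplicial e V u, u != v & ~~ e v u].
Proof.
have [n] := ubnP #|V|; elim: n => // n IH in V v w * => Vn vV wV wv vw.
pose Q z := [&& z \in V, z != v & ~~ e v z].
have Qw : Q w by rewrite /Q wV wv.
pose f := [rel a b | [&& Q a, Q b & e a b]].
have f_sym : symmetric f by move=> a b; rewrite /= e_sym andbCA.
pose H := [set h | connect f w h].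
pose S := [set x in V | e v x && [exists h in H, e h x]].
have wH : w \in H by rewrite inE.
have HQ h : h \in H -> Q h.
  rewrite inE => /connectP[p /(path_restrict_rel Qw)/andP[_ /allP aQ] ->].
  by rewrite aQ // mem_last.
have HN h x : h \in H -> x \in V -> e h x -> x \in H :|: S.
  move=> hH xV hx; have Qh := HQ h hH; have /and3P[hV hv vh] := Qh; rewrite inE.
  have [vx|vx] := boolP (e v x).
    by apply/orP; right; rewrite inE xV vx; apply/exists_inP; exists h.
  rewrite inE; apply/orP; left; rewrite inE in hH; apply: connect_trans hH _.
  apply: connect1; rewrite /= Qh hx andbT /Q xV vx andbT /=.
  by apply: contraNneq vh => <-; rewrite e_sym.
have Scl : {in S &, forall x y, x != y -> e x y}.
  move=> x y; rewrite !inE => /and3P[xV vx /exists_inP[hx hxH hxx]].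
  move=> /and3P[yV vy /exists_inP[hy hyH hyy]] xy.
  have : connect f hx hy.
    rewrite !inE in hxH hyH; apply: connect_trans hyH.
    by rewrite (sym_connect_sym f_sym).
  case/connectP => p /(path_restrict_rel (HQ _ hxH))/andP[pp aQ] hyE.
  have px : path e x (hx :: rcons p y).
    by rewrite /= rcons_path pp -hyE hyy e_sym hxx.
  have lx : last x (hx :: rcons p y) = y by rewrite /= last_rcons.
  (* The path from [x] through [H] to [y] is made simple; its interior stays in [H], away from [v]
     and its neighbours. *)
  case: (shortenP px) lx => r pr ur sr lr.
  rewrite -lr; apply: (bypass_adjacent (v := v)); rewrite ?lr // 1?eq_sym //.
  apply/allP => z /sr; rewrite -rcons_cons mem_rcons inE.
  by case: eqVneq => //= _ /(allP aQ)/and3P[_ -> ->].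
pose V' := H :|: S.
have V'V : V' \subset V :\ v.
  apply/subsetP => z /setUP[/HQ/and3P[zV zv _]|]; first by rewrite !inE zv.
  rewrite !inE => /and3P[-> vz _]; rewrite andbT.
  by apply: contraTneq vz => ->; rewrite e_irr.
have V'n : #|V'| < n.
  have := subset_leq_card V'V; move: Vn; rewrite (cardsD1 v V) vV => Vn V'V1.
  exact: leq_ltn_trans V'V1 Vn.
(* By [HN], a vertex of [H] has all its [V]-neighbours in [V'], so being simplicial transfers. *)
have lift u : u \in H -> simplicial e V' u ->
    exists u, [/\ simplicial e V u, u != v & ~~ e v u].
  move=> uH [_ su]; have /and3P[uV uv vu] := HQ u uH; exists u; split=> //.
  by split=> // x y xV yV ux uy; apply: su; rewrite // (HN u).
have wV' : w \in V' by rewrite inE wH.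
(* Induction with [t] in the role of [v]: the vertex found is not adjacent to [t], hence not in [S],
   hence in [H]. *)
have step t z : t \in V' -> z \in V' -> z != t -> ~~ e t z ->
    {in S, forall s, s != t -> e t s} ->
    exists u, [/\ simplicial e V u, u != v & ~~ e v u].
  move=> tV' zV' zt tz St; have [u [su ut tu]] := IH V' t z V'n tV' zV' zt tz.
  apply: (lift u) => //; have := su.1; rewrite inE => /orP[//|uS].
  by rewrite St in tu.
have [/exists_inP[t tS /exists_inP[z zV' /andP[zt tz]]]|] :=
    boolP [exists t in S, exists z in V', (z != t) && ~~ e t z].
  apply: (step t z) => //; first by rewrite inE tS orbT.
  by move=> s sS st; apply: Scl; rewrite // eq_sym.
rewrite negb_exists_in => /forall_inP SV.
have {}SV s z : s \in S -> z \in V' -> z != s -> e s z.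
  move=> sS zV' zs; apply: contraR (SV s sS) => sz.
  by apply/exists_inP; exists z; rewrite ?zs.
have [/exists_inP[t tH /exists_inP[z zV' /andP[zt tz]]]|] :=
    boolP [exists t in H, exists z in V', (z != t) && ~~ e t z].
  have tV' : t \in V' by rewrite inE tH.
  by apply: (step t z) => // s sS st; rewrite e_sym SV // eq_sym.
rewrite negb_exists_in => /forall_inP HV.
(* Now [V'] is a clique, so [w] itself is simplicial in it. *)
apply: (lift w) => //; split=> // x y /setUP[xH|xS] yV' _ _ xy.
  apply: contraR (HV x xH) => nxy; apply/exists_inP.
  by exists y; rewrite // eq_sym xy.
by rewrite SV // eq_sym.
Qed.

Lemma chordal_simplicial (V : {set T}) :
  V != set0 -> exists v, simplicial e V v.
Proof.
case/set0Pn => v vV.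
have [/exists_inP[x xV /exists_inP[y yV /andP[yx xy]]]|] :=
    boolP [exists x in V, exists y in V, (y != x) && ~~ e x y].
  by have [u [su _ _]] := simplicial_nonadjacent xV yV yx xy; exists u.
rewrite negb_exists_in => /forall_inP V0.
exists v; split=> // x y xV yV _ _ xy; apply: contraR (V0 x xV) => nxy.
by apply/exists_inP; exists y; rewrite // eq_sym xy.
Qed.
End Dirac.

(** * The closed neighbourhood ideal *)

Section ClosedNeighbourhoodIdeal.
Variables (K : fieldType) (T : finType) (e : rel T).
Implicit Types (a : {ffun T -> nat}) (F : {set T}).

(** The exponent of [b] stays positive whether or not [b] is in [F], so membership in the ideal
    ignores [b]. *)
Lemma koszul_cell_cone a (b : T) F : 1 < a b ->
  koszul_cell (NI_gens e) a (b |: F) = koszul_cell (NI_gens e) a (F :\ b).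
Proof.
move=> ab; congr (_ && ~~ _).
  apply/forall_inP/forall_inP => aF x; rewrite !inE => xF.
    by apply: aF; rewrite !inE; case/andP: xF => _ ->; rewrite orbT.
  by case: eqVneq xF => [-> _|xb /= xF]; [exact: ltnW|rewrite aF // !inE xb].
apply: eq_has => g; apply: eq_forallb => w; congr (_ ==> _).
rewrite !ffunE !inE; case: eqVneq => //= ->.
by rewrite subn0 subn_gt0 ab ltnW.
Qed.

(** The generator of [u] fails to divide x^(a-F) iff some [w] in its closed neighbourhood has
    exponent 0, that is, lies in [F] or outside [Y]. *)
Lemma koszul_cell_squarefree a F : (forall x, a x <= 1) ->
  let Y := [set x | 0 < a x] in
  koszul_cell (NI_gens e) a F = dom_family e setT set0 Y (~: Y) F.
Proof.
move=> a1 Y; rewrite /dom_family /= sub0set /=; congr (_ && _).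
  by apply/forall_inP/subsetP => aF x /aF; rewrite inE.
rewrite /mon_in has_map -all_predC; apply/allP/dominatesP => [gF u _|dF u _].
  have := gF u (mem_enum _ _); rewrite /= negb_forall_in => /exists_inP[w].
  rewrite !inE !ffunE => wu; rewrite -leqNgt leqn0 subn_eq0 => aw.
  exists w; rewrite !inE; split=> //; move: aw; case: (w \in F) => //=.
  by rewrite -leqNgt.
have [w [_ wF wu]] := dF u (in_setT u).
rewrite /= negb_forall_in; apply/exists_inP; exists w; first by rewrite !inE.
rewrite ffunE -leqNgt leqn0 subn_eq0; move: wF; rewrite !inE.
by case: (w \in F) => //=; rewrite -leqNgt.
Qed.

Lemma mdeg_squarefree a : (forall x, a x <= 1) -> mdeg a = #|[set x | 0 < a x]|.
Proof.
move=> a1; rewrite /mdeg -sum1_card [RHS]big_mkcond /=; apply: eq_bigr => x _.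
by rewrite inE; have := a1 x; case: (a x) => [|[]].
Qed.
End ClosedNeighbourhoodIdeal.

Theorem theorem3p2 (K : fieldType)
    (K_infinite : forall s : seq K, exists x : K, x \notin s)
    (T : finType) (e : rel T)
    (e_sym : symmetric e) (e_irr : irreflexive e)
    (e_chordal : chordal e) :
  is_regularity K (NI_gens e) (Posz (vertex_cover_number e)).
Proof.
have ex_simp := chordal_simplicial e_sym e_irr e_chordal.
have coverP C : reflect (covers e setT C) (vertex_cover e C).
  apply: (iffP forallP) => [cC x y _ _|cC x].
    by move/forallP: (cC x) => /(_ y) /implyP.
  by apply/forallP => y; apply/implyP/cC.
rewrite /vertex_cover_number; case: arg_minnP => [|C0 /coverP cC0 minC0].
  by apply/coverP => x y; rewrite !inE.
have upper i a : betti K (NI_gens e) i a != 0 -> mdeg a <= #|C0| + i.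
  move/eqP => bn; rewrite leqNgt; apply/negP => lt; apply/bn/betti_eq0.
  have [/existsP[b ab]|] := boolP [exists b, 1 < a b].
    apply: (exact_at_cone (x := b)); first exact: convex_koszul_cell.
    by move=> F; apply: koszul_cell_cone.
  rewrite negb_exists => /forallP a1.
  have {}a1 x : a x <= 1 by rewrite leqNgt.
  pose Y := [set x | 0 < a x].
  apply: (eq_exact_at (P := dom_family e setT set0 Y (~: Y))).
    by move=> F; rewrite koszul_cell_squarefree.
  apply: (dom_family_exact e_sym e_irr ex_simp _ cC0).
    by apply/subsetP => x; rewrite !inE orbN.
  by rewrite -mdeg_squarefree.
split=> [|i a /upper]; last by rewrite lerBlDr -PoszD lez_nat.
have [|C [m [_ cC mC nex]]] :=
  dom_family_not_exact e_sym e_irr K ex_simp (V := setT) (X := set0).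
  by rewrite disjoint_sym disjoints_subset sub0set.
rewrite set0U in mC nex.
pose a := [ffun _ : T => 1%N].
have a1 x : a x <= 1 by rewrite ffunE.
have aT : [set x | 0 < a x] = setT by apply/setP => x; rewrite !inE ffunE.
have ma : mdeg a = #|[set: T]| by rewrite mdeg_squarefree // aT.
have bn : betti K (NI_gens e) m a != 0.
  apply/eqP => /betti_eq0 ex; apply: nex; apply: eq_exact_at ex => F.
  by rewrite koszul_cell_squarefree // aT setCT.
exists m, a; split=> //; rewrite ma -mC PoszD addrC addKr.
(* The bound [upper], applied to the nonzero Betti number just found, forces [C] to be a minimum
   cover. *)
congr Posz; apply/eqP; rewrite eqn_leq (minC0 C) ?andbT; last exact/coverP.
by have := upper _ _ bn; rewrite ma -mC addnC leq_add2r.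
Qed.
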